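(* For all integers $n\ge 0$ and $k\ge 1$ and all $x\in\mathbb{C}$, $$\widehat{C}_n^{(k)}(x)=B_n^{(n-k+1)}(x-k+1)=\sum_{l=0}^{n}\sum_{i=0}^{l}\ \sum_{j_1+\cdots+j_k=i}\binom{i}{j_1,\dots,j_k}\binom{l}{i}S_1(n,l)\,x^{l-i}\frac{(-1)^i}{(j_1+1)\cdots(j_k+1)},$$ where the innermost sum runs over $k$-tuples of nonnegative integers $(j_1,\dots,j_k)$ with sum $i$.
   Context: $(x)_n = x(x-1)\cdots(x-n+1)$ denotes the falling factorial, with $(x)_0=1$. For integers $k\ge1$, $n\ge0$, the higher-order Cauchy polynomials of the second kind (of order $k$) are $$\widehat{C}_n^{(k)}(x)=\int_0^1\cdots\int_0^1 (x-(x_1+\cdots+x_k))_n\,dx_1\cdots dx_k.$$ $S_1(n,l)$ are the signed Stirling numbers of the first kind, defined by $(x)_n=\sum_{l=0}^n S_1(n,l)x^l$. $\binom{i}{j_1,\dots,j_k}=\frac{i!}{j_1!\cdots j_k!}$. For an integer $\alpha$ (possibly zero or negative), the Bernoulli polynomials $B_n^{(\alpha)}(x)$ of order $\alpha$ are defined by the formal power series identity $\left(\frac{t}{e^t-1}\right)^{\alpha}e^{xt}=\sum_{n=0}^\infty B_n^{(\alpha)}(x)\frac{t^n}{n!}$. Convention: $0^0=1$. *)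

(* Defs.v *)
From HB Require Import structures.
From mathcomp Require Import all_boot all_order all_algebra.
From mathcomp Require Import all_classical all_reals all_analysis.
From mathcomp Require Import complex.

Set Implicit Arguments.
Unset Strict Implicit.
Unset Printing Implicit Defensive.

Import Order.TTheory GRing.Theory Num.Theory.

Local Open Scope ring_scope.

Definition falling (A : pzRingType) (x : A) (n : nat) : A :=
  \prod_(i < n) (x - i%:R).

(* Signed Stirling numbers of the first kind: the coefficient of X^l in the
   falling factorial polynomial (X)_n; see [falling_stirling1]. *)
Definition stirling1 (n l : nat) : int := (falling ('X : {poly int}) n)`_l.

(* Formal power series over K are represented by their coefficient
   sequences nat -> K. *)
Definition fps_mul (K : fieldType) (a b : nat -> K) : nat -> K :=
  fun n => \sum_(i < n.+1) a i * b (n - i)%N.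

Definition fps_one (K : fieldType) : nat -> K := fun n => (n == 0%N)%:R.

(* The first n coefficients of 1 / a, obtained by solving a * (1 / a) = 1
   coefficient by coefficient; meaningful when a 0 != 0. *)
Fixpoint fps_inv_prefix (K : fieldType) (a : nat -> K) (n : nat) : seq K :=
  if n is m.+1 then
    let s := fps_inv_prefix a m in
    rcons s ((a 0%N)^-1 * ((m == 0%N)%:R - \sum_(i < m) s`_i * a (m - i)%N))
  else [::].

Definition fps_inv (K : fieldType) (a : nat -> K) : nat -> K :=
  fun n => (fps_inv_prefix a n.+1)`_n.

Definition fps_exp (K : fieldType) (a : nat -> K) (n : nat) : nat -> K :=
  iter n (fps_mul a) (@fps_one K).

Definition fps_expz (K : fieldType) (a : nat -> K) (z : int) : nat -> K :=
  match z with
  | Posz n => fps_exp a n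
  | Negz n => fps_exp (fps_inv a) n.+1
  end.

(* The series e^(x t). *)
Definition fps_expR (K : fieldType) (x : K) : nat -> K :=
  fun n => x ^+ n / n`!%:R.

(* The series t / (e^t - 1), as the inverse of (e^t - 1) / t, whose n-th
   coefficient is that of t^(n+1) in e^t; see [fps_todd_expm1]. *)
Definition fps_todd (K : fieldType) : nat -> K :=
  fps_inv (fun n => fps_expR 1 n.+1).

(* Bernoulli polynomials of integer order alpha:
   (t / (e^t - 1)) ^ alpha * e^(x t) = \sum_n B_n^(alpha)(x) t^n / n! *)
Definition bernoulli (K : fieldType) (alpha : int) (n : nat) (x : K) : K :=
  n`!%:R * fps_mul (fps_expz (@fps_todd K) alpha) (fps_expR x) n.

(* Integral over [0, 1] of a complex-valued function of a real variable. *)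
Definition cint01 (R : realType) (f : R -> R[i]) : R[i] :=
  Complex (\int[@lebesgue_measure R]_(t in `[0, 1]%classic) complex.Re (f t))
          (\int[@lebesgue_measure R]_(t in `[0, 1]%classic) complex.Im (f t)).

(* Iterated integral over [0, 1]^k. *)
Fixpoint cint_cube (R : realType) (k : nat) :
    (k.-tuple R -> R[i]) -> R[i] :=
  match k with
  | 0 => fun F => F [tuple]
  | m.+1 => fun F =>
      cint01 (fun t => cint_cube (fun s : m.-tuple R => F [tuple of t :: s]))
  end.

(* Higher-order Cauchy polynomials of the second kind. *)
Definition cauchy2 (R : realType) (k n : nat) (x : R[i]) : R[i] :=
  cint_cube (fun s : k.-tuple R =>
    falling (x - real_complex R (\sum_(m < k) tnth s m)) n).

Definition multinom {K : fieldType} (k i : nat) (j : 'I_k -> nat) : K :=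
  i`!%:R / \prod_(m < k) (j m)`!%:R.

Lemma size_falling_poly (A : nzRingType) n :
  (size (falling ('X : {poly A}) n) = n.+1)%N.
Proof.
rewrite /falling.
rewrite (eq_bigr (fun i : 'I_n => 'X - (i%:R)%:P)); last first.
  by move=> i _; rewrite polyC_natr.
by rewrite size_prod_XsubC /index_enum -enumT size_enum_ord.
Qed.

Lemma falling_stirling1 (K : comNzRingType) (x : K) n :
  falling x n = \sum_(l < n.+1) (stirling1 n l)%:~R * x ^+ l.
Proof.
have -> : falling x n = (map_poly (intr : int -> K) (falling 'X n)).[x].
  rewrite /falling rmorph_prod horner_prod; apply: eq_bigr => i _.
  by rewrite rmorphB /= map_polyX rmorph_nat hornerD hornerX hornerN -polyC_natr hornerC.
rewrite (horner_coef_wide (n := n.+1)); last first.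
  by rewrite (leq_trans (size_poly _ _)) // size_falling_poly.
by apply: eq_bigr => l _; rewrite coef_map.
Qed.

Lemma size_fps_inv_prefix (K : fieldType) (a : nat -> K) n :
  size (fps_inv_prefix a n) = n.
Proof. by elim: n => //= n IHn; rewrite size_rcons IHn. Qed.

Lemma nth_fps_inv_prefix (K : fieldType) (a : nat -> K) n i :
  (i < n)%N -> (fps_inv_prefix a n)`_i = fps_inv a i.
Proof.
elim: n => // n IHn; rewrite ltnS leq_eqVlt => /orP[/eqP -> //|lt_in].
by rewrite [LHS]/= nth_rcons size_fps_inv_prefix lt_in IHn.
Qed.

Lemma fps_mulVs (K : fieldType) (a : nat -> K) :
  a 0%N != 0 -> fps_mul (fps_inv a) a =1 @fps_one K.
Proof.
move=> a0 n; rewrite /fps_mul /fps_one big_ord_recr /= subnn.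
rewrite {2}/fps_inv /= nth_rcons size_fps_inv_prefix ltnn eqxx.
rewrite mulrAC mulVf // mul1r addrC.
rewrite [X in _ - X](eq_bigr (fun i : 'I_n => fps_inv a i * a (n - i)%N)).
  by rewrite subrK.
by move=> i _; rewrite nth_fps_inv_prefix.
Qed.

Lemma fps_todd_expm1 (K : numFieldType) (n : nat) :
  fps_mul (@fps_todd K) (fun m => fps_expR 1 m - fps_one K m) n
  = (n == 1%N)%:R.
Proof.
rewrite /fps_mul big_ord_recr /= subnn.
rewrite /fps_expR /fps_one fact0 expr0 divr1 subrr mulr0 addr0.
case: n => [|n]; first by rewrite big_ord0.
rewrite eqSS -[RHS](@fps_mulVs K (fun n => fps_expR 1 n.+1)); last first.
  by rewrite /fps_expR expr1n mul1r invr_eq0 pnatr_eq0 -lt0n fact_gt0.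
by apply: eq_bigr => i _; rewrite subSn -1?ltnS //= subr0.
Qed.

Lemma bernoulli_gen (K : numFieldType) (alpha : int) (x : K) (n : nat) :
  fps_mul (fps_expz (@fps_todd K) alpha) (fps_expR x) n
  = bernoulli alpha n x / n`!%:R.
Proof. by rewrite mulrAC divff ?mul1r // pnatr_eq0 -lt0n fact_gt0. Qed.

(* Main.v *)
Require Import Defs.
From HB Require Import structures.
From mathcomp Require Import all_boot all_order all_algebra.
From mathcomp Require Import all_classical all_reals all_analysis.
From mathcomp Require Import complex.
From mathcomp Require Import ring.

Set Implicit Arguments.
Unset Strict Implicit.
Unset Printing Implicit Defensive.

Import Order.TTheory GRing.Theory Num.Theory.
Import numFieldNormedType.Exports.

Local Open Scope ring_scope.

(** Everything is read off formal power series in t. Write E(y) for e^(y t),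
    Q = (e^t - 1) / t and T = 1 / Q = t / (e^t - 1).

    Averaging over a unit interval is multiplication by Q: since
    Q E(y - 1) is the integral of E(y - s) over s in [0, 1], for every series a
      int_0^1 [t^n] (a E(y - s)) ds = [t^n] (a Q E(y - 1)),
    and k iterations ([cint_cube_avg]) turn the integral over the cube into
      [t^n] (a Q^k E(y - k)).
    Both equalities follow by writing the integrand (y)_n in the form
    [t^n] (a E(y)) in two different ways.

    - (y)_n = n! [t^n] (T^(n+1) E(y + 1)), that is (y)_n = B_n^(n+1)(y + 1)
      ([falling_todd]). With theta = t d/dt one has theta T = T - T^2 - t T;
      applying theta to T^n E(z) and comparing coefficients of t^n, the two
      terms n [t^n] (T^n E(z)) cancel, leaving the recursion
      (y)_n = (y - n + 1) (y)_(n-1). Here a Q^k E(x - k) becomes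
      n! T^(n+1) Q^k E(x - k + 1) = n! T^(n-k+1) E(x - k + 1), whose coefficient
      is the Bernoulli polynomial.

    - (y)_n is the sum of the S_1(n, l) y^l, where y^l = l! [t^l] E(y)
      ([falling_expR]). Here one needs l! [t^l] (Q^k E(x - k)). As
      Q E(-1) = (1 - e^(-t)) / t has coefficients (-1)^i / (i+1)!, writing
      Q^k E(x - k) = (Q E(-1))^k E(x) and expanding the k-th power gives the
      sum over k-tuples ([coef_avg_expR_multinom]). *)

(** * The ring of formal power series *)

(** The product of [nat -> K] as a type of functions is the pointwise one; the
    alias leaves room for the Cauchy product. *)
Definition fps (K : Type) : Type := nat -> K.

HB.instance Definition _ (K : fieldType) := GRing.Zmodule.copy (fps K) (nat -> K).

Section FpsRing.
Variable K : fieldType.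
Implicit Types a b c : fps K.

Definition fps_trunc (N : nat) a : {poly K} := \poly_(i < N) a i.

Lemma coef_fps_trunc N a i : (i < N)%N -> (fps_trunc N a)`_i = a i.
Proof. by move=> iN; rewrite coef_poly iN. Qed.

(** Coefficients of a product below N depend only on those of the factors below
    N, so the ring laws of series are inherited from polynomials. *)
Lemma fps_mul_coef N a b i (p q : {poly K}) : (i < N)%N ->
  (forall j, (j < N)%N -> p`_j = a j) -> (forall j, (j < N)%N -> q`_j = b j) ->
  (p * q)`_i = fps_mul a b i.
Proof.
move=> iN pa qb; rewrite coefM; apply: eq_bigr => j _.
rewrite pa ?qb //; first by rewrite (leq_ltn_trans (leq_subr _ _)).
by rewrite (leq_trans (ltn_ord j)).
Qed.

Lemma fps_mulC : commutative (@fps_mul K : fps K -> fps K -> fps K).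
Proof.
move=> a b; apply/funext => n; rewrite -(fps_mul_coef (ltnSn n)
  (@coef_fps_trunc n.+1 a) (@coef_fps_trunc n.+1 b)) mulrC.
exact: (fps_mul_coef (ltnSn n) (@coef_fps_trunc n.+1 b) (@coef_fps_trunc n.+1 a)).
Qed.

Lemma fps_mulA : associative (@fps_mul K : fps K -> fps K -> fps K).
Proof.
move=> a b c; apply/funext => n.
pose p d := fps_trunc n.+1 d.
have tr d j : (j < n.+1)%N -> (p d)`_j = d j by exact: coef_fps_trunc.
have trM d e j (jn : (j < n.+1)%N) := fps_mul_coef jn (tr d) (tr e).
rewrite -(fps_mul_coef (ltnSn n) (tr a) (trM b c)) mulrA.
exact: (fps_mul_coef (ltnSn n) (trM a b) (tr c)).
Qed.

Lemma fps_mul1 : left_id (@fps_one K : fps K) (@fps_mul K).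
Proof.
move=> a; apply/funext => n; rewrite /fps_mul big_ord_recl subn0 big1.
  by rewrite addr0 /fps_one mul1r.
by move=> i _; rewrite /fps_one mul0r.
Qed.

Lemma fps_mulDl : left_distributive (@fps_mul K : fps K -> fps K -> fps K) +%R.
Proof.
move=> a b c; apply/funext => n.
transitivity (fps_mul a c n + fps_mul b c n); last by [].
by rewrite /fps_mul -big_split /=; apply: eq_bigr => i _; exact: mulrDl.
Qed.

Lemma fps_one_neq0 : (@fps_one K : fps K) != 0.
Proof.
by apply/eqP => /(congr1 (fun a : fps K => a 0%N)) /eqP; apply/negP; exact: oner_neq0.
Qed.

HB.instance Definition _ := GRing.Zmodule_isComNzRing.Build (fps K)
  fps_mulA fps_mulC fps_mul1 fps_mulDl fps_one_neq0.

Lemma coef_fpsM a b n : (a * b) n = \sum_(i < n.+1) a i * b (n - i)%N.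
Proof. by []. Qed.

Lemma fps_mulE a b : fps_mul a b = a * b.
Proof. by []. Qed.

Lemma coef_fps1 n : (1 : fps K) n = (n == 0)%:R. Proof. by []. Qed.
Lemma coef_fpsD a b n : (a + b) n = a n + b n. Proof. by []. Qed.
Lemma coef_fpsN a n : (- a) n = - a n. Proof. by []. Qed.

Lemma coef_fpsMn a m n : (a *+ m) n = a n *+ m.
Proof. by elim: m => // m IHm; rewrite !mulrS coef_fpsD IHm. Qed.

Lemma fps_expE a m : fps_exp a m = a ^+ m.
Proof. by elim: m => // m IHm; rewrite exprS -IHm. Qed.

Lemma coef_fps_trunc_exp N a k i :
  (i < N)%N -> (fps_trunc N a ^+ k)`_i = (a ^+ k) i.
Proof.
elim: k i => [|k IHk] i iN; first by rewrite !expr0 coef1.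
by rewrite !exprS; exact: (fps_mul_coef iN (@coef_fps_trunc N a) IHk).
Qed.

(** Distributivity applied to the k-th power of the truncation of a. *)
Lemma coef_fps_exp a k i : (a ^+ k) i =
  \sum_(j : {ffun 'I_k -> 'I_i.+1} | (\sum_(m < k) (j m : nat))%N == i)
    \prod_(m < k) a (j m).
Proof.
rewrite -(coef_fps_trunc_exp a k (ltnSn i)) -[k in LHS]card_ord -prodr_const.
rewrite /fps_trunc; under eq_bigr do rewrite poly_def.
rewrite bigA_distr_bigA coef_sum [RHS]big_mkcond; apply: eq_bigr => j _ /=.
rewrite scaler_prod prodrXr coefZ coefXn eq_sym.
by case: eqP => _; rewrite ?mulr1 ?mulr0.
Qed.

(** Scalars enter as constant series so that identities mixing scalars and
    series are decided in one commutative ring. *)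
Definition fpsC (r : K) : fps K := fun n => r * (n == 0)%:R.
Definition fpsX : fps K := fun n => (n == 1)%:R.

Lemma coef_fpsCM (r : K) a n : (fpsC r * a) n = r * a n.
Proof.
rewrite coef_fpsM big_ord_recl subn0 big1 ?addr0 /fpsC ?mulr1 // => i _.
by rewrite mulr0 mul0r.
Qed.

Lemma coef_fpsXM a n : (fpsX * a) n.+1 = a n.
Proof.
rewrite coef_fpsM 2!big_ord_recl big1 /fpsX; last by move=> i _; rewrite mul0r.
by rewrite mul0r add0r addr0 mul1r subSS subn0.
Qed.

Lemma coef_fpsXM0 a : (fpsX * a) 0 = 0.
Proof. by rewrite coef_fpsM big_ord1 /fpsX mul0r. Qed.

(** The derivation t d/dt; compared to d/dt, it shifts no index. *)
Definition fps_euler a : fps K := fun n => n%:R * a n.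

Lemma fps_eulerM a b :
  fps_euler (a * b) = fps_euler a * b + a * fps_euler b.
Proof.
apply/funext => n; rewrite coef_fpsD !coef_fpsM -big_split /= /fps_euler.
rewrite coef_fpsM mulr_sumr; apply: eq_bigr => i _.
have /subnKC {1}<- : (i <= n)%N by rewrite -ltnS.
by rewrite natrD; ring.
Qed.

Lemma fps_euler1 : fps_euler 1 = 0.
Proof. by apply/funext => -[|n]; rewrite /fps_euler ?mul0r // coef_fps1 mulr0. Qed.

Lemma fps_euler_exp a m : fps_euler (a ^+ m.+1) = fps_euler a * a ^+ m *+ m.+1.
Proof.
elim: m => [|m IHm]; first by rewrite expr0 mulr1.
by rewrite exprS fps_eulerM IHm exprS; ring.
Qed.

Lemma fps_inv_unique a b : b * a = 1 -> fps_inv a = b.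
Proof.
move=> ba1; have a0 : a 0%N != 0.
  apply/eqP => a0; have := congr1 (fun c : fps K => c 0%N) ba1.
  rewrite coef_fpsM big_ord1 a0 mulr0 => /eqP.
  by rewrite eq_sym; apply/negP; exact: oner_neq0.
pose u : fps K := fps_inv a.
have ua1 : u * a = 1 by apply/funext => n; exact: fps_mulVs.
by rewrite -[LHS]/u -[u]mulr1 -ba1 mulrCA ua1 mulr1.
Qed.

End FpsRing.

(** * Exponentials, (e^t - 1) / t and its inverse *)

Section BernoulliBase.
Variable K : numFieldType.

Lemma factn_neq0 n : n`!%:R != 0 :> K.
Proof. by rewrite pnatr_eq0 -lt0n fact_gt0. Qed.

Lemma fps_expRD (y z : K) :
  (fps_expR (y + z) : fps K) = (fps_expR y : fps K) * fps_expR z.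
Proof.
apply/funext => n; rewrite /fps_expR addrC exprDn coef_fpsM mulr_suml.
apply: eq_bigr => i _; have le_in : (i <= n)%N by rewrite -ltnS.
have Cn : 'C(n, i)%:R * i`!%:R * (n - i)`!%:R = n`!%:R :> K.
  by rewrite -!natrM -mulnA bin_fact.
rewrite -mulr_natr -Cn; field.
by rewrite !factn_neq0 pnatr_eq0 -lt0n bin_gt0 le_in.
Qed.

Lemma fps_expR0 : (fps_expR 0 : fps K) = 1.
Proof.
apply/funext => -[|n]; rewrite /fps_expR ?fact0 ?expr0 ?divr1 //.
by rewrite exprS !mul0r.
Qed.

Lemma fps_expRX (y : K) k : (fps_expR y : fps K) ^+ k = fps_expR (k%:R * y).
Proof.
elim: k => [|k IHk]; first by rewrite mul0r fps_expR0.
by rewrite exprS IHk -fps_expRD mulrSr mulrDl mul1r addrC.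
Qed.

(** The series (e^t - 1) / t, the integral of e^(s t) over s in [0, 1]. *)
Definition fps_avg : fps K := fun n => fps_expR 1 n.+1.

Lemma todd_avg : (@fps_todd K : fps K) * fps_avg = 1.
Proof.
apply/funext => n; apply: fps_mulVs.
by rewrite /fps_expR expr1n mul1r invr_eq0 factn_neq0.
Qed.

Lemma fps_inv_todd : fps_inv (@fps_todd K) = fps_avg.
Proof. by apply: (@fps_inv_unique K); rewrite mulrC todd_avg. Qed.

Lemma fpsX_avg : fpsX K * fps_avg = (fps_expR 1 : fps K) - 1.
Proof.
apply/funext => -[|n]; rewrite ?coef_fpsXM0 ?coef_fpsXM coef_fpsD coef_fpsN.
  by rewrite coef_fps1 /fps_expR expr0 fact0 divr1 subrr.
by rewrite coef_fps1 subr0.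
Qed.

Lemma coef_avg_expR (y : K) n :
  (fps_avg * fps_expR y) n = fps_expR (y + 1) n.+1 - fps_expR y n.+1.
Proof.
rewrite -coef_fpsXM mulrA fpsX_avg mulrBl mul1r -fps_expRD addrC.
by rewrite coef_fpsD coef_fpsN addrC [y + 1]addrC.
Qed.

Lemma expz_todd (n k : nat) :
  (fps_expz (@fps_todd K) (n%:Z - k%:Z) : fps K)
  = (@fps_todd K : fps K) ^+ n * fps_avg ^+ k.
Proof.
have [le_kn|lt_nk] := leqP k n.
  rewrite subzn //= fps_expE -{2}(subnK le_kn) exprD -mulrA -exprMn todd_avg.
  by rewrite expr1n mulr1.
have -> : n%:Z - k%:Z = Negz (k - n).-1.
  by rewrite NegzE prednK ?subn_gt0 // -subzn 1?ltnW // opprB.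
transitivity (fps_exp (fps_inv (@fps_todd K)) (k - n).-1.+1); first by [].
rewrite fps_expE fps_inv_todd prednK ?subn_gt0 //.
by rewrite -{2}(subnK (ltnW lt_nk)) exprD mulrCA -exprMn todd_avg expr1n mulr1.
Qed.

(** * The falling factorial as a Bernoulli polynomial *)

Lemma fps_euler_expR (y : K) :
  fps_euler (fps_expR y) = fpsX K * (fpsC y * (fps_expR y : fps K)).
Proof.
apply/funext => -[|n]; first by rewrite coef_fpsXM0 /fps_euler mul0r.
rewrite coef_fpsXM coef_fpsCM /fps_euler /fps_expR factS natrM exprS.
field; rewrite factn_neq0 /=.
by rewrite addrC natr1 pnatr_eq0.
Qed.

Lemma fps_euler_avg :
  fps_euler fps_avg = 1 + fpsX K * fps_avg - fps_avg.
Proof.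
rewrite fpsX_avg addrC [X in _ = _ + X]addrC subrK addrC.
apply/funext => n; rewrite coef_fpsD coef_fpsN /fps_euler /fps_avg /fps_expR.
rewrite !expr1n factS natrM; field; rewrite factn_neq0 /=.
by rewrite addrC natr1 pnatr_eq0.
Qed.

(** Applying the derivation to T Q = 1 and multiplying by T expresses theta T
    through theta Q, which is e^t - Q. *)
Lemma fps_euler_todd (T := @fps_todd K : fps K) :
  fps_euler T = T - T ^+ 2 - fpsX K * T.
Proof.
have := congr1 (@fps_euler K) todd_avg.
rewrite fps_eulerM fps_euler1 fps_euler_avg -/T => dT.
have TQ : T * fps_avg = 1 := todd_avg.
have -> : fps_euler T = fps_euler T * (T * fps_avg) by rewrite TQ mulr1.
have -> : fps_euler T * (T * fps_avg) = T * (fps_euler T * fps_avg) by ring.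
rewrite -[fps_euler T * _](addrK (T * (1 + fpsX K * fps_avg - fps_avg))) dT.
have -> : T * (1 + fpsX K * fps_avg - fps_avg) =
  T + fpsX K * (T * fps_avg) - T * fps_avg by ring.
by rewrite TQ; ring.
Qed.

(** The coefficient of t^(n+1) in theta (T^(n+1) E(z)), computed once as
    n + 1 times a coefficient and once by the Leibniz rule. The exponent of T
    equals the index of the coefficient: this is what makes the terms in
    [t^(n+1)] (T^(n+1) E(z)) cancel. *)
Lemma coef_todd_rec (z : K) n (T := @fps_todd K : fps K) :
  n.+1%:R * (T ^+ n.+2 * fps_expR z) n.+1
  = (z - n.+1%:R) * (T ^+ n.+1 * fps_expR z) n.
Proof.
have : fps_euler (T ^+ n.+1 * fps_expR z) =
   (T ^+ n.+1 * fps_expR z) *+ n.+1 - (T ^+ n.+2 * fps_expR z) *+ n.+1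
   - fpsX K * (T ^+ n.+1 * fps_expR z) *+ n.+1
   + fpsX K * (fpsC z * (T ^+ n.+1 * fps_expR z)).
  rewrite fps_eulerM fps_euler_exp fps_euler_todd fps_euler_expR -/T !exprS.
  by move: (T ^+ n) (fps_expR z : fps K) => Tn E; ring.
move/(congr1 (fun a : fps K => a n.+1)); rewrite !coef_fpsD !coef_fpsN !coef_fpsMn.
rewrite !coef_fpsXM coef_fpsCM /fps_euler => eqn.
apply/eqP; rewrite -subr_eq0; apply/eqP.
move/eqP: eqn; rewrite -subr_eq0 => /eqP <-.
move: ((T ^+ n.+1 * _) n.+1) ((T ^+ n.+2 * _) n.+1) ((T ^+ n.+1 * _) n) => A B C.
by ring.
Qed.

Lemma falling_todd (y : K) n (T := @fps_todd K : fps K) :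
  falling y n = n`!%:R * (T ^+ n.+1 * fps_expR (y + 1)) n.
Proof.
elim: n => [|n IHn]; rewrite /falling ?big_ord0 ?big_ord_recr /=.
  rewrite coef_fpsM big_ord1 expr1 fact0 mul1r /fps_expR expr0 fact0 divr1 mulr1.
  have := congr1 (fun a : fps K => a 0) todd_avg.
  rewrite coef_fpsM big_ord1 /fps_avg /fps_expR expr1n factS fact0 muln1.
  by rewrite divr1 mulr1 => T0; exact: esym.
transitivity (n`!%:R * (n.+1%:R * (T ^+ n.+2 * fps_expR (y + 1)) n.+1)).
  rewrite -/(falling y n) IHn coef_todd_rec -/T.
  by move: ((T ^+ n.+1 * _) n) => A; ring.
by rewrite factS natrM mulrCA mulrA.
Qed.

End BernoulliBase.

(** * Integration over the cube *)

Section CubeIntegral.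
Variable R : realType.
Notation C := R[i].

Lemma Rintegral01_deriv (p : {poly R}) :
  \int[@lebesgue_measure R]_(t in `[0, 1]%classic) (deriv p).[t] = p.[1] - p.[0].
Proof.
rewrite /Rintegral (@continuous_FTC2 _ _ (horner p)) //=.
- by apply: continuous_subspaceT; exact: continuous_horner.
- split=> [t _||]; first exact: derivable_horner.
  + by apply: cvg_at_right_filter; exact: continuous_horner.
  + by apply: cvg_at_left_filter; exact: continuous_horner.
- by move=> t _; rewrite -derivE.
Qed.

(** Meant for f the real or the imaginary part: not ring morphisms, but linear
    over the reals, which is enough at a real point. *)
Lemma horner_real_additive (f : {additive C -> R}) (p : {poly C}) (t : R) :
  (forall z s, f (z * real_complex R s) = f z * s) ->
  f p.[real_complex R t] = (map_poly f p).[t].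
Proof.
move=> fM; rewrite horner_coef raddf_sum (horner_coef_wide _ (size_poly _ _)).
apply: eq_bigr => i _.
by rewrite -rmorphXn fM coef_map_id0 ?raddf0.
Qed.

Lemma additive_map_deriv (f : {additive C -> R}) (p : {poly C}) :
  map_poly f (deriv p) = deriv (map_poly f p).
Proof.
apply/polyP => i; rewrite coef_deriv !coef_map_id0 ?raddf0 //.
by rewrite coef_deriv raddfMn.
Qed.

Lemma cint01_deriv (p : {poly C}) :
  cint01 (fun t => (deriv p).[real_complex R t]) = p.[1] - p.[0].
Proof.
pose re : {additive C -> R} := @complex.Re R.
pose im : {additive C -> R} := @complex.Im R.
have reM z s : re (z * real_complex R s) = re z * s.
  by case: z => a b; rewrite /= mulr0 subr0.
have imM z s : im (z * real_complex R s) = im z * s.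
  by case: z => a b; rewrite /= mulr0 add0r.
have int (f : {additive C -> R}) :
    (forall z s, f (z * real_complex R s) = f z * s) ->
    \int[@lebesgue_measure R]_(t in `[0, 1]%classic) f (deriv p).[real_complex R t]
    = f (p.[1] - p.[0]).
  move=> fM; under eq_Rintegral do rewrite horner_real_additive// additive_map_deriv.
  by rewrite Rintegral01_deriv -!horner_real_additive // raddfB.
rewrite /cint01 [X in Complex X _](int re) // [X in Complex _ X](int im) //.
by case: (_ - _).
Qed.

(** As a function of s, [t^n] (a E(y - s)) is a polynomial, so the fundamental
    theorem of calculus applies; the endpoint difference of its primitive is
    the corresponding coefficient of Q E(y - 1) = (E(y) - E(y - 1)) / t. *)
Lemma cint01_avg (a : fps C) (y : C) n :
  cint01 (fun t => (a * fps_expR (y - real_complex R t)) n)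
  = (a * fps_avg C * fps_expR (y - 1)) n.
Proof.
pose P : {poly C} := \sum_(i < n.+1)
  (- a i / (n - i).+1`!%:R) *: (y%:P - 'X) ^+ (n - i).+1.
have -> : (fun t => (a * fps_expR (y - real_complex R t)) n)
        = (fun t => (deriv P).[real_complex R t]).
  apply/funext => t; rewrite coef_fpsM raddf_sum horner_sum; apply: eq_bigr => i _.
  rewrite /= derivZ deriv_exp derivB derivC derivX sub0r hornerZ hornerMn.
  rewrite hornerM horner_exp !hornerE /fps_expR factS natrM /= -mulr_natr.
  by field; rewrite factn_neq0 /= addrC natr1 pnatr_eq0.
rewrite cint01_deriv -mulrA coef_fpsM !horner_sum -sumrB; apply: eq_bigr => i _.
rewrite coef_avg_expR subrK /fps_expR !hornerZ !horner_exp !hornerE subr0.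
by ring.
Qed.

(** The induction generalizes a and y: the inner integral, with the outer
    variable t fixed, is the statement at y - t, and its value is again of the
    form [t^n] (b E(y' - t)), with b = a Q^k and y' = y - k. *)
Lemma cint_cube_avg (k n : nat) (a : fps C) (y : C) :
  cint_cube (fun s : k.-tuple R =>
    (a * fps_expR (y - real_complex R (\sum_(m < k) tnth s m))) n)
  = (a * fps_avg C ^+ k * fps_expR (y - k%:R)) n.
Proof.
elim: k a y => [|k IHk] a y /=.
  by rewrite big_ord0 rmorph0 subr0 expr0 mulr1.
transitivity (cint01 (fun t =>
    (a * fps_avg C ^+ k * fps_expR ((y - k%:R) - real_complex R t)) n)).
  congr cint01; apply/funext => t; rewrite addrAC -IHk.
  congr cint_cube; apply/funext => s.
  have -> : \sum_(m < k.+1) tnth [tuple of t :: s] m = t + \sum_(m < k) tnth s m.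
    rewrite big_ord_recl tnth0; congr (_ + _).
    by apply: eq_bigr => m _; rewrite tnthS.
  by rewrite rmorphD opprD addrA.
by rewrite cint01_avg -(mulrA a) -exprSr -addrA -opprD natr1.
Qed.

End CubeIntegral.

(** * The expansion in Stirling numbers *)

Section Stirling.
Variable K : numFieldType.

Lemma avg_expRN1 :
  fps_avg K * fps_expR (- 1) = (fun i => (- 1) ^+ i / i.+1`!%:R) :> fps K.
Proof.
apply/funext => i; rewrite coef_avg_expR addNr /fps_expR exprS mul0r mul0r.
by rewrite sub0r exprS mulN1r mulNr opprK.
Qed.

(** Reversing c makes the sum of the c_l b_l for l <= n a coefficient of a
    Cauchy product. *)
Definition fps_rev (n : nat) (c : fps K) : fps K := fun i => c (n - i)%N.

Definition fps_stirling1 (n : nat) : fps K :=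
  fun l => (stirling1 n l)%:~R * l`!%:R.

Lemma coef_fpsM_rev (c b : fps K) n :
  (fps_rev n c * b) n = \sum_(l < n.+1) c l * b l.
Proof.
rewrite coef_fpsM (reindex_inj rev_ord_inj); apply: eq_bigr => l _ /=.
by rewrite subSS /fps_rev subKn // -ltnS ltn_ord.
Qed.

Lemma falling_expR (y : K) n : falling y n =
  (fps_rev n (fps_stirling1 n) * fps_expR y) n.
Proof.
rewrite falling_stirling1 coef_fpsM_rev.
apply: eq_bigr => l _; rewrite /fps_stirling1 /fps_expR.
by rewrite mulrA [X in X / _]mulrAC mulfK ?factn_neq0.
Qed.

(** Q^k E(x - k) = (Q E(-1))^k E(x), where Q E(-1) has the coefficients
    (-1)^i / (i+1)!. The sign of a term depends only on the sum i of the tuple,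
    and (j+1)! = (j+1) j! splits off the multinomial coefficient. *)
Lemma coef_avg_expR_multinom (k l : nat) (x : K) :
  l`!%:R * (fps_avg K ^+ k * fps_expR (x - k%:R)) l =
  \sum_(i < l.+1)
      \sum_(j : {ffun 'I_k -> 'I_i.+1} | (\sum_(m < k) (j m : nat))%N == i)
        (multinom i (fun m => j m : nat) : K) * 'C(l, i)%:R
        * x ^+ (l - i) * ((-1) ^+ i / \prod_(m < k) ((j m).+1)%:R).
Proof.
rewrite addrC -mulrN1 fps_expRD -fps_expRX mulrA -exprMn avg_expRN1.
rewrite coef_fpsM mulr_sumr; apply: eq_bigr => i _.
rewrite coef_fps_exp mulr_suml mulr_sumr; apply: eq_bigr => j /eqP sumj.
rewrite prodf_div prodrXr sumj /multinom.
have -> : \prod_(m < k) (j m).+1`!%:R =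
    \prod_(m < k) (j m).+1%:R * \prod_(m < k) (j m)`!%:R :> K.
  by rewrite -big_split; apply: eq_bigr => m _; rewrite factS natrM.
rewrite /fps_expR.
have le_il : (i <= l)%N by rewrite -ltnS.
rewrite -(bin_fact le_il) !natrM.
field.
have pn (F : 'I_k -> nat) : (forall m, (0 < F m)%N) -> \prod_(m < k) (F m)%:R != 0 :> K.
  by move=> F0; apply/prodf_neq0 => m _; rewrite pnatr_eq0 -lt0n.
by rewrite factn_neq0 !pn // => m; rewrite fact_gt0.
Qed.

End Stirling.

Theorem theorem2p7 (R : realType) (n k : nat) (x : R[i]) (hk : (1 <= k)%N) :
  cauchy2 k n x = bernoulli (n%:Z - k%:Z + 1) n (x - k%:R + 1)
  /\
  bernoulli (n%:Z - k%:Z + 1) n (x - k%:R + 1) =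
    \sum_(0 <= l < n.+1) \sum_(0 <= i < l.+1)
      \sum_(j : {ffun 'I_k -> 'I_i.+1} | (\sum_(m < k) (j m : nat))%N == i)
        (multinom i (fun m => j m : nat) : R[i]) * 'C(l, i)%:R
        * (stirling1 n l)%:~R * x ^+ (l - i)
        * ((-1) ^+ i / \prod_(m < k) ((j m).+1)%:R).
Proof.
have cauchyB : cauchy2 k n x = bernoulli (n%:Z - k%:Z + 1) n (x - k%:R + 1).
  have -> : n%:Z - k%:Z + 1 = n.+1%:Z - k%:Z by rewrite intS [1 + _]addrC addrAC.
  (* The integrand is [t^n] (a E(x - s)); the extra factor E(1) in a accounts
     for the shift in (y)_n = B_n^(n+1)(y + 1). *)
  pose a : fps R[i] := fpsC n`!%:R * ((@fps_todd R[i] : fps R[i]) ^+ n.+1 * fps_expR 1).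
  transitivity (cint_cube (fun s : k.-tuple R =>
      (a * fps_expR (x - real_complex R (\sum_(m < k) tnth s m))) n)).
    congr cint_cube; apply/funext => s.
    by rewrite falling_todd -coef_fpsCM -[in RHS]mulrA -(mulrA (_ ^+ _)) -fps_expRD
      [1 + _]addrC.
  have mulE (c u v w z : fps R[i]) : c * (u * v) * w * z = c * (u * w * (z * v)).
    by ring.
  rewrite (cint_cube_avg k n a x) /a mulE coef_fpsCM.
  by rewrite /bernoulli fps_mulE expz_todd -fps_expRD.
split=> //; rewrite -cauchyB.
transitivity (cint_cube (fun s : k.-tuple R =>
  (fps_rev n (fps_stirling1 R[i] n) *
   fps_expR (x - real_complex R (\sum_(m < k) tnth s m))) n)).
  by congr cint_cube; apply/funext => s; rewrite falling_expR.
rewrite cint_cube_avg -mulrA coef_fpsM_rev big_mkord.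
apply: eq_bigr => l _; rewrite -mulrA coef_avg_expR_multinom big_mkord mulr_sumr.
apply: eq_bigr => i _; rewrite mulr_sumr; apply: eq_bigr => j _.
move: (stirling1 n l)%:~R => S.
by ring.
Qed.
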